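(* Let $G$ be a finite group. Let $S$ be a nonabelian finite simple group which is not isomorphic to any of the following groups: (1) $A_{n}(q)=\mathrm{PSL}_{n+1}(q)$ with $q=p^{f}$ and $n+1>2$; (2) $D_{n}(q)$ with $q=p^{f}$ when $n=4$ or $p=2$; (3) $E_{6}(q)$ with $q=p^f$; (4) ${}^2A_{n}(q)$ with $n>1$. If exactly one composition factor of $G$ (counted with multiplicity) is isomorphic to $S$, then $\beta(G)$ is not solvable.
   Context: For a finite group $G$ and $N\trianglelefteq G$, define the rational number $m_{G,N}=\frac{1}{|G|}\sum_{X\le G,\ XN=G}|X|\,\mu(X,G)$, where $\mu$ is the Möbius function of the poset of subgroups of $G$. If $N\trianglelefteq G$ is maximal (with respect to inclusion) among normal subgroups with $m_{G,N}\neq 0$, set $\beta(G)=G/N$; this is well defined up to isomorphism (any two such maximal $N$ give isomorphic quotients). Here $q$ is a power of a prime $p$, and $A_n(q)$, $D_n(q)$, $E_6(q)$, ${}^2A_n(q)$ denote the usual (Chevalley / twisted Chevalley) finite simple groups of Lie type. Other nonabelian simple groups may occur as composition factors of $G$. *)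

(* Defs.v *)
From HB Require Import structures.
From mathcomp Require Import all_boot all_order all_algebra all_fingroup all_solvable.
From mathcomp Require Import mpoly.

Set Implicit Arguments.
Unset Strict Implicit.
Unset Printing Implicit Defensive.

Import GRing.Theory.
Local Open Scope group_scope.

Section Mobius.
Variable gT : finGroupType.

(* mob_rec G k X : recursion mu(G,G) = 1,
   mu(X,G) = - sum_{X < Y <= G} mu(Y,G); k is fuel, #|G| suffices. *)
Fixpoint mob_rec (G : {set gT}) (k : nat) (X : {set gT}) : int :=
  if X == G then 1%R else
  match k with
  | 0 => 0%R
  | k'.+1 => (- \sum_(Y : {group gT} | (X \proper Y) && (Y \subset G))
                  mob_rec G k' Y)%R
  end.

Definition mobius (X G : {set gT}) : int := mob_rec G #|G| X.

Definition mGN (G N : {set gT}) : rat :=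
  ((#|G|%:R)^-1 *
   \sum_(X : {group gT} | (X \subset G) && ((X * N)%g == G))
      (#|X|%:R * (mobius X G)%:~R))%R.

(* N is a normal subgroup, maximal among those with m_{G,N} <> 0;
   beta(G) = G / N *)
Definition beta_kernel (G N : {group gT}) : bool :=
  [max N of M | (M <| G) && (mGN G M != 0%R)].

Definition count_factors (sT : finGroupType) (S : {set sT})
    (G : {group gT}) (s : seq {group gT}) : nat :=
  count (fun p : {group gT} * {group gT} => (p.1 / p.2) \isog S)
        (zip (G :: s) s).
End Mobius.

Section Classical.
Variable F : finFieldType.
Local Open Scope ring_scope.

Definition SLset (n : nat) : {set {'GL_n.+1[F]}} :=
  [set g : {'GL_n.+1[F]} | \det (GLval g) == 1%R].
Definition PSL (n : nat) := (SLset n / 'Z(SLset n))%g.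

(* ^2A_n(q) = PSU_{n+1}(q), F of order q^2, involution x |-> x^q;
   unitary group of the standard hermitian form (all are equivalent). *)
Definition SUset (q n : nat) : {set {'GL_n.+1[F]}} :=
  [set g : {'GL_n.+1[F]} | (\det (GLval g) == 1%R) &&
     ((map_mx (fun x : F => x ^+ q) (GLval g))^T *m GLval g == 1%R)].
Definition PSU (q n : nat) := (SUset q n / 'Z(SUset q n))%g.

(* D_n(q) = P Omega^+_{2n}(q): Omega = derived subgroup of the isometry group
   of the hyperbolic quadratic form Q(v) = sum_{i<n} v_i v_{n+i} on F^{2n}. *)
Definition hypQ (n : nat) (v : 'rV[F]_(n + n).-1.+1) : F :=
  (\sum_(i < (n + n).-1.+1 | (i < n)%N) v 0 i * v 0 (inord (i + n)))%R.
Definition Oplus (n : nat) : {set {'GL_(n + n)[F]}} :=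
  [set g : {'GL_(n + n)[F]} | [forall v, hypQ (v *m GLval g) == hypQ v]].
Definition Omegaplus (n : nat) := [~: Oplus n, Oplus n]%g.
Definition POmegaplus (n : nat) := (Omegaplus n / 'Z(Omegaplus n))%g.

(* E_6(q): derived subgroup of the isometry group (as a polynomial identity)
   of Dickson's cubic form  det A + det B + det C - tr(ABC)  on
   F^27 = M_3(F)^3, modulo its centre. *)
Definition dickson (R : comRingType) (v : 'rV[R]_27) : R :=
  let M (k : nat) := \matrix_(i < 3, j < 3) v 0 (inord (9 * k + 3 * i + j)) in
  (\det (M 0%N) + \det (M 1%N) + \det (M 2%N) - \tr (M 0%N *m M 1%N *m M 2%N))%R.

Definition genvec : 'rV[{mpoly F[27]}]_27 := \row_(i < 27) 'X_i.

Definition E6iso : {set {'GL_27[F]}} :=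
  [set g : {'GL_27[F]} |
     dickson (genvec *m map_mx (fun c : F => c%:MP) (GLval g)) == dickson genvec].
Definition E6der := [~: E6iso, E6iso]%g.
Definition E6ad := (E6der / 'Z(E6der))%g.
End Classical.

(* Main.v *)
Require Import Defs.
From HB Require Import structures.
From mathcomp Require Import all_boot all_order all_algebra all_fingroup all_solvable.

(** Only the solvability of [G / N] matters: if [m_{G,N} <> 0] and [G / N] is
    solvable, then [N] is solvable, hence so are [G] and all its composition
    factors.  The proof is an induction using
    [m_{G,N} = m_{G,M} m_{G/M,N/M}] for [M <= N].  This reduces to [N] perfect;
    and if [A <> 1] is an abelian normal subgroup of [G], one may pass to
    [G / A], either because [A] meets [N], or because [A] centralizes the
    perfect group [N], and then supplements of [N] not containing [A] have zero
    Moebius value.  There remains the case in which [O_r(G) = 1] for all primes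
    [r].  If [G = N], then [|G| m_{G,G}] counts the generators of the noncyclic
    group [G].  Otherwise let [K / N <> 1] be a normal [r]-subgroup of [G / N].
    By Sylow's theorem
      [|X| = \sum_W |N_X(W)|], [W] ranging over [Syl_r(X :&: K)],
    for each supplement [X] of [N].  Exchanging sums, the terms for a given [W]
    depend on [X] only through [X :&: N_G(W)], as [W] is Sylow in [X :&: K] iff
    it is Sylow in [N_{X :&: K}(W)], and [N_X(W)] is again a supplement by the
    Frattini argument.  Since [N_G(W) < G], their sum weighted by the Moebius
    function vanishes by Weisner's theorem. *)

Set Implicit Arguments.
Unset Strict Implicit.
Unset Printing Implicit Defensive.

Import GroupScope GRing.Theory Num.Theory.

(** * Moebius function of the subgroup lattice *)

(** Each recursive call raises the order of the subgroup, so a chain from [X] up to [G] has at most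
    [#|G| - #|X|] steps and fuel beyond that is never consumed. *)
Lemma mob_rec_fuel (gT : finGroupType) (G X : {group gT}) (j k : nat) :
    X \subset G -> (#|G| - #|X| <= j)%N -> (#|G| - #|X| <= k)%N ->
  mob_rec G j X = mob_rec G k X.
Proof.
elim: j k X => [|j IHj] k X sXG; rewrite ?leqn0 ?subn_eq0 => le_j le_k.
  have -> : (X : {set gT}) = G by apply/eqP; rewrite eqEcard sXG.
  by case: k {le_k} => [|k] /=; rewrite eqxx.
have [eqXG | neXG] := eqVneq (X : {set gT}) G.
  by rewrite eqXG; case: k {le_k} => [|k] /=; rewrite eqxx.
have ltXG : (#|X| < #|G|)%N by rewrite proper_card // properEneq neXG.
case: k le_k => [|k] le_k; first by rewrite leqn0 subn_eq0 leqNgt ltXG in le_k.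
rewrite /= (negPf neXG); congr (- _)%R.
apply: eq_bigr => Y /andP[/proper_card ltXY sYG].
have ltYG : (#|G| - #|Y| < #|G| - #|X|)%N by rewrite ltn_sub2l.
by apply: IHj => //; rewrite -ltnS; apply: leq_trans ltYG _.
Qed.

Lemma mobiusE (gT : finGroupType) (G X : {group gT}) :
    X \proper G ->
  mobius X G = (- \sum_(Y : {group gT} | (X \proper Y) && (Y \subset G)) mobius Y G)%R.
Proof.
move=> ltXG; have neXG : (X : {set gT}) != G by apply: contraTneq ltXG => ->; rewrite properxx.
rewrite /mobius; case Dk: #|G| (cardG_gt0 G) => [|k] // _.
rewrite [LHS]/= (negPf neXG); congr (- _)%R; apply: eq_bigr => Y /andP[ltXY sYG].
apply: mob_rec_fuel => //; rewrite Dk.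
  (* One unit of fuel is already spent; the remaining [#|G| - 1] suffices because [#|Y| >= 1]. *)
  rewrite leq_subLR -add1n leq_add2r; exact: cardG_gt0.
exact: leq_subr.
Qed.

Lemma mobiusid (gT : finGroupType) (G : {group gT}) : mobius G G = 1%R.
Proof. by rewrite /mobius; case: #|G| => [|k] /=; rewrite eqxx. Qed.

Lemma sum_mobius (gT : finGroupType) (G X : {group gT}) :
    X \subset G ->
  (\sum_(Y : {group gT} | (X \subset Y) && (Y \subset G)) mobius Y G
     = (X == G)%:R)%R.
Proof.
move=> sXG; rewrite (bigD1 X) ?subxx //=.
rewrite (eq_bigl (fun Y : {group gT} => (X \proper Y) && (Y \subset G))); last first.
  move=> Y; rewrite properEneq andbAC eq_sym; congr (_ && _).
  by rewrite andbC.
have [-> | neXG] := eqVneq X G.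
  rewrite mobiusid big_pred0 ?addr0 // => Y.
  by apply/negP=> /andP[/proper_sub_trans h /h]; rewrite properxx.
by rewrite mobiusE ?addNr // properEneq sXG andbT.
Qed.

(** Downward induction on [D]. The Moebius values of all [X] containing [D] sum to 0, as [D] lies in
    [L] and so differs from [G]. Splitting this sum by [E = X :&: L], the classes with [E] larger
    than [D] vanish by induction, leaving the class of [D]. *)
Lemma weisner (gT : finGroupType) (G L D : {group gT}) :
    ~~ (G \subset L) ->
  (\sum_(X : {group gT} | (X \subset G) && ((X :&: L)%G == D)) mobius X G = 0)%R.
Proof.
move=> nsGL; have [k] := ubnP (#|gT| - #|D|); elim: k D => // k IHk D ltk.
have [/subsetIP[sDG sDL] | nsD] := boolP (D \subset G :&: L); last first.
  rewrite big_pred0 // => X; apply: contraNF nsD => /andP[sXG /eqP <-].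
  exact: setSI.
have := sum_mobius sDG.
have /negPf-> : D != G by apply: contraNneq nsGL => <-.
rewrite (partition_big (fun X => X :&: L)%G (fun E : {group gT} => D \subset E)) /=; last first.
  by move=> X /andP[sDX sXG]; rewrite subsetI sDX.
rewrite (bigD1 D) //= [X in (_ + X)%R]big1 ?addr0 => [sumD|E /andP[sDE neED]].
  rewrite -[RHS]sumD; apply: eq_bigl => X.
  apply/andP/andP=> [[sXG /eqP eqD]|[/andP[_ ->] ->]] //.
  by rewrite sXG eqD -{1}eqD subsetIl.
apply: etrans (IHk E _); last first.
  have ltDE : D \proper E by rewrite properEneq eq_sym neED.
  rewrite -ltnS; apply: leq_trans ltk; rewrite ltnS ltn_sub2l ?proper_card //.
  exact: proper_sub_trans ltDE (subset_predT _).
apply: eq_bigl => X; apply/andP/andP=> [[/andP[_ ->] ->]|[sXG /eqP eqE]] //.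
by rewrite sXG eqE eqxx; split=> //; rewrite (subset_trans sDE) // -eqE subsetIl.
Qed.

(** The form in which Weisner's theorem is applied: any weight that sees [X] only through [X :&: L]
    is constant on the classes of [weisner]. *)
Lemma sum_mobius_setI (gT : finGroupType) (G L : {group gT}) (phi : {group gT} -> int) :
    ~~ (G \subset L) ->
  (\sum_(X : {group gT} | X \subset G) phi (X :&: L)%G * mobius X G = 0)%R.
Proof.
move=> nsGL; rewrite (partition_big (fun X => X :&: L)%G xpredT) //=.
apply: big1 => D _.
rewrite (eq_bigr (fun X : {group gT} => phi D * mobius X G)%R).
  by rewrite -mulr_sumr weisner ?mulr0.
by move=> X /andP[_ /eqP->].
Qed.

(** * Sums over supplements and their behaviour under quotients *)

(** This is [#|G| * m_{G,N}], which stays in the integers. *)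
Definition supp_sum (gT : finGroupType) (G N : {group gT}) : int :=
  (\sum_(X : {group gT} | (X \subset G) && (X * N == G)%g)
      #|X|%:R * mobius X G)%R.

Lemma mGN_neq0 (gT : finGroupType) (G N : {group gT}) :
  (mGN G N != 0%R) = (supp_sum G N != 0%R).
Proof.
rewrite /mGN mulf_eq0 invr_eq0 pnatr_eq0 eqn0Ngt cardG_gt0 /=.
rewrite -(intr_eq0 rat) /supp_sum rmorph_sum /=.
by under [in RHS]eq_bigr do rewrite intrM natz -pmulrn.
Qed.

Lemma overgroup_ind (gT : finGroupType) (G : {group gT}) (P : {group gT} -> Prop) :
    (forall X : {group gT}, X \subset G ->
       (forall Y : {group gT}, X \proper Y -> Y \subset G -> P Y) -> P X) ->
  forall X : {group gT}, X \subset G -> P X.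
Proof.
move=> IH X; have [k] := ubnP (#|G| - #|X|); elim: k X => // k IHk X ltk sXG.
apply: IH => // Y ltXY sYG; apply: IHk => //.
rewrite -ltnS; apply: leq_trans ltk; rewrite ltnS ltn_sub2l ?proper_card //.
exact: proper_sub_trans ltXY sYG.
Qed.

(** Moebius inversion on the interval from [M] to [G]: sums over upper intervals determine a
    function, from the top down. *)
Lemma mobius_unique (gT : finGroupType) (G M : {group gT}) (a : {group gT} -> int) c :
    (forall Y : {group gT}, M \subset Y -> Y \subset G ->
      \sum_(Z : {group gT} | (Y \subset Z) && (Z \subset G)) a Z
        = c * (Y == G)%:R)%R ->
  forall Y : {group gT}, M \subset Y -> Y \subset G -> a Y = (c * mobius Y G)%R.
Proof.
move=> sum_a Y sMY sYG; move: Y sYG sMY; apply: overgroup_ind => Y sYG IH sMY.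
have := sum_a Y sMY sYG; rewrite -sum_mobius // mulr_sumr.
have eq_a (Z : {group gT}) :
  (Y \subset Z) && (Z \subset G) && (Z != Y) -> a Z = (c * mobius Z G)%R.
  case/andP=> /andP[sYZ sZG] neZY; apply: IH => //; last exact: subset_trans sYZ.
  by rewrite properEneq eq_sym neZY.
rewrite !(bigD1 (P := fun Z : {group gT} => (Y \subset Z) && (Z \subset G)) Y) ?subxx //=.
by rewrite (eq_bigr _ eq_a) => /addIr.
Qed.

Lemma sum_quotient (gT : finGroupType) (G M : {group gT}) (P : pred {group coset_of M})
    (F : {group coset_of M} -> int) : M <| G ->
  (\sum_(Z : {group coset_of M} | (Z \subset (G / M)%g) && P Z) F Z =
   \sum_(Y : {group gT} | [&& M \subset Y, Y \subset G & P (Y / M)%G])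
      F (Y / M)%G)%R.
Proof.
move=> nsMG; have [sMG nMG] := andP nsMG.
rewrite (reindex_onto (fun Y : {group gT} => Y / M)%G
           (fun Z : {group coset_of M} => coset M @*^-1 Z)%G) /=; last first.
  by move=> Z _; apply/val_inj; rewrite /= cosetpreK.
apply: eq_bigl => Y; apply/andP/and3P=> [[/andP[sYG PY] /eqP eqY]|[sMY sYG PY]].
  split=> //; first by rewrite -eqY /= sub_cosetpre.
  by rewrite -eqY /= sub_cosetpre_quo.
rewrite quotientS // PY; split=> //; apply/eqP/val_inj; rewrite /= quotientGK //.
by rewrite /normal sMY (subset_trans sYG).
Qed.

(** The correspondence theorem carries the upper-interval sums of [G / M] to those above [M] in [G],
    so uniqueness applies with constant 1. *)
Lemma mobius_quotient (gT : finGroupType) (G M Y : {group gT}) :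
    M <| G -> M \subset Y -> Y \subset G ->
  mobius (Y / M)%G (G / M)%G = mobius Y G.
Proof.
move=> nsMG sMY sYG; have [sMG nMG] := andP nsMG.
have nM (Z : {group gT}) : Z \subset G -> Z \subset 'N(M).
  by move/subset_trans; apply.
rewrite (@mobius_unique _ G M (fun Z => mobius (Z / M)%G (G / M)%G) 1%R) ?mul1r //.
move=> {sMY sYG} Y sMY sYG; rewrite mul1r.
have <- : (Y / M == G / M)%G = (Y == G).
  apply/eqP/eqP=> [eqYG|-> //]; apply/val_inj/eqP; rewrite eqEsubset /= sYG.
  by rewrite -(quotientSGK nMG sMY); have /= -> := congr1 val eqYG.
rewrite -sum_mobius ?quotientS //.
under [in RHS]eq_bigl do rewrite andbC.
rewrite (sum_quotient (fun Z : {group coset_of M} => (Y / M)%g \subset Z) _ nsMG).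
apply: eq_bigl => Z; apply/andP/and3P=> [[sYZ sZG]|[sMZ sZG]].
  by split; rewrite ?quotientS // (subset_trans sMY).
by rewrite quotientSGK ?nM.
Qed.

Lemma supp_sum_quotient (gT : finGroupType) (G M N : {group gT}) :
    M <| G -> N <| G ->
  (supp_sum (G / M)%G (N / M)%G * #|M|%:R =
   \sum_(Y : {group gT} | [&& M \subset Y, Y \subset G & ((Y * N)%g == G)])
      #|Y|%:R * mobius Y G)%R.
Proof.
move=> nsMG nsNG; have [sMG nMG] := andP nsMG; have [sNG nNG] := andP nsNG.
rewrite /supp_sum sum_quotient // mulr_suml; apply: eq_big => [Y|Y].
  apply: andb_id2l => sMY; apply: andb_id2l => sYG; rewrite /=.
  have nMY := subset_trans sYG nMG; have nMN := subset_trans sNG nMG.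
  rewrite -quotientMl //; apply/eqP/eqP=> [eqYN|-> //].
  have nsM_YN : M <| Y <*> N.
    by rewrite /normal (subset_trans sMY) ?joing_subl // join_subG nMY.
  rewrite -(quotientGK nsMG) -eqYN -norm_joinEl ?(subset_trans sYG) //.
  by rewrite quotientGK.
case/and3P=> sMY sYG _; rewrite mobius_quotient // mulrAC -natrM.
by rewrite /= card_quotient ?(subset_trans sYG) // mulnC Lagrange.
Qed.

(** This is [m_{G,N} = m_{G,M} m_{G/M,N/M}] with denominators cleared. Supplements [X] of [N] are
    grouped by [Y = XM], where [|X| |M| = |Y| |X :&: M|]. *)
Lemma supp_sum_mul (gT : finGroupType) (G M N : {group gT}) :
    M <| G -> N <| G -> M \subset N ->
  (#|G : M|%:R * supp_sum G N = supp_sum G M * supp_sum (G / M)%G (N / M)%G)%R.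
Proof.
move=> nsMG nsNG sMN; have [sMG nMG] := andP nsMG.
have joinM (X : {group gT}) : X \subset G -> X <*> M = (X * M)%g.
  by move=> sXG; rewrite norm_joinEl // (subset_trans sXG).
(* Inner sum of the grouping. Its upper-interval sums vanish below [G], so it equals [a G] times the
   Moebius value of [Y]. *)
pose a (Y : {group gT}) : int :=
  (\sum_(X : {group gT} | (X \subset G) && ((X <*> M)%G == Y))
      #|X :&: M|%:R * mobius X G)%R.
have sum_a (Y : {group gT}) : M \subset Y -> Y \subset G ->
    (\sum_(Z : {group gT} | (Y \subset Z) && (Z \subset G)) a Z
       = a G * (Y == G)%:R)%R.
  move=> sMY sYG; have [-> | neYG] := eqVneq Y G.
    rewrite mulr1 (big_pred1 G) // => Z.
    by rewrite andbC -eqEsubset -val_eqE.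
  rewrite mulr0; have nsGY : ~~ (G \subset Y).
    by apply: contra neYG => sGY; rewrite -val_eqE eqEsubset sYG.
  (* By Dedekind's law [Y] lies in [XM] iff [(X :&: Y)M = Y]; and [X :&: M = (X :&: Y) :&: M] since
     [M] lies in [Y]. So both condition and weight depend only on [X :&: Y]. *)
  pose phi (D : {group gT}) : int :=
    (if (D * M)%g == Y then #|D :&: M|%:R else 0)%R.
  transitivity (\sum_(X : {group gT} | (X \subset G) && (((X :&: Y) * M)%g == Y))
                  #|X :&: M|%:R * mobius X G)%R; last first.
    rewrite -[RHS](sum_mobius_setI phi nsGY) big_mkcondr; apply: eq_bigr => X _.
    rewrite /phi /= -setIA (setIidPr sMY).
    by case: ifP => // _; rewrite mul0r.
  apply/esym; rewrite (partition_big (fun X : {group gT} => X <*> M)%G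
     (fun Z : {group gT} => (Y \subset Z) && (Z \subset G))) /=; last first.
    move=> X /andP[sXG /eqP eqY]; rewrite join_subG sXG sMG andbT.
    by rewrite joinM // -{1}eqY mulSg ?subsetIl.
  apply: eq_bigr => Z /andP[sYZ sZG]; apply: eq_bigl => X.
  rewrite -!andbA; apply: andb_id2l => sXG; apply: andb_idl => /eqP eqZ.
  rewrite setIC group_modr //; apply/eqP/setIidPl.
  by rewrite -joinM //; move/(congr1 val): eqZ => /= ->.
have aE := mobius_unique sum_a.
have aG : (supp_sum G M = #|G : M|%:R * a G)%R.
  rewrite /supp_sum /a mulr_sumr; apply: eq_big => [X | X /andP[sXG /eqP eqG]].
    by apply: andb_id2l => sXG; rewrite -joinM.
  rewrite mulrA -natrM; congr (_%:R * _)%R; apply/eqP.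
  rewrite -(eqn_pmul2r (cardG_gt0 M)) mul_cardG eqG.
  by rewrite mulnAC [(_ * #|M|)%N]mulnC Lagrange.
rewrite aG -mulrA; congr (_ * _)%R.
have M_neq0 : (#|M|%:R != 0 :> int)%R by rewrite pnatr_eq0 -lt0n cardG_gt0.
apply: (mulIf M_neq0); rewrite -mulrA supp_sum_quotient // mulr_sumr.
rewrite (eq_bigr (fun Y : {group gT} => #|Y|%:R * a Y)%R); last first.
  by move=> Y /and3P[sMY sYG _]; rewrite (aE Y) // mulrCA.
rewrite /supp_sum mulr_suml (partition_big (fun X : {group gT} => X <*> M)%G
   (fun Y : {group gT} => [&& M \subset Y, Y \subset G & (Y * N)%g == G])) /=; last first.
  move=> X /andP[sXG /eqP eqG].
  by rewrite joing_subr join_subG sXG sMG joinM // -mulgA (mulSGid sMN) eqG /=.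
apply: eq_bigr => Y /and3P[sMY sYG /eqP eqG]; rewrite /a mulr_sumr.
apply: eq_big => [X | X /andP[/andP[sXG _] /eqP eqY]].
  rewrite -andbA; apply: andb_id2l => sXG; apply: andb_idl => /eqP eqY.
  by rewrite -eqG -eqY /= joinM // -mulgA (mulSGid sMN).
rewrite mulrAC mulrA -!natrM mul_cardG -joinM //.
by move/(congr1 val): eqY => /= ->.
Qed.

(** * Vanishing of the sum, and reduction modulo an abelian normal subgroup *)

(** Writing [|X|] as a count of its elements and exchanging sums, the term of [x] depends only on [X
    :&: <[x]>], with [<[x]>] proper in [G]. *)
Lemma supp_sum_noncyclic (gT : finGroupType) (G : {group gT}) :
  ~~ cyclic G -> supp_sum G G = 0%R.
Proof.
move=> ncG; rewrite /supp_sum.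
transitivity (\sum_(X : {group gT} | X \subset G) \sum_(x in G)
                (x \in X)%:R * mobius X G)%R.
  apply: eq_big => [X | X /andP[sXG _]].
    by apply: andb_idr => sXG; rewrite mulSGid.
  rewrite -mulr_suml -natr_sum -big_mkcondr /= sum1dep_card.
  by congr (_%:R * _)%R; apply: eq_card => x; rewrite inE andb_idl // => /(subsetP sXG).
rewrite exchange_big /=; apply: big1 => x Gx.
have nsGx : ~~ (G \subset <[x]>).
  apply: contra ncG => sGx; apply/cyclicP; exists x.
  by apply/eqP; rewrite eqEsubset sGx cycle_subG.
pose phi (D : {group gT}) : int := ((x \in D)%:R)%R.
rewrite -[RHS](sum_mobius_setI phi nsGx); apply: eq_bigr => X _.
by rewrite /phi /= inE cycle_id andbT.
Qed.

(** If [n1 = x1 a1] and [n2 = x2 a2], the factors [a1], [a2] commute with [x1] and [x2], so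
    [[~ n1, n2] = [~ x1, x2]] lies in [X]; such commutators generate [N]. *)
Lemma perfect_supplement_sub (gT : finGroupType) (A N X : {group gT}) :
    abelian A -> A \subset 'C(N) -> N \subset [~: N, N] -> N \subset X * A ->
  N \subset X.
Proof.
move=> cAA cNA pN sNXA; apply: subset_trans pN _; rewrite gen_subG.
have decomp n : n \in N -> exists x a, [/\ x \in X, a \in A & n = x * a].
  by move/(subsetP sNXA)/mulsgP=> [x a Xx Aa ->]; exists x, a.
apply/subsetP=> _ /imset2P[n1 n2 Nn1 Nn2 ->].
have [x1 [a1 [Xx1 Aa1 def1]]] := decomp _ Nn1.
have [x2 [a2 [Xx2 Aa2 def2]]] := decomp _ Nn2.
have cAn a n : a \in A -> n \in N -> commute a n.
  by move=> /(subsetP cNA)/centP cNa /cNa.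
have cAx a x b n : a \in A -> b \in A -> n \in N -> n = x * b -> commute a x.
  move=> Aa Ab Nn defn; have -> : x = n * b^-1 by rewrite defn mulgK.
  by apply: commuteM; [exact: cAn | apply/commuteV/(centsP cAA)].
have c11 := cAx _ _ _ _ Aa1 Aa1 Nn1 def1; have c12 := cAx _ _ _ _ Aa1 Aa2 Nn2 def2.
have c21 := cAx _ _ _ _ Aa2 Aa1 Nn1 def1; have c22 := cAx _ _ _ _ Aa2 Aa2 Nn2 def2.
have fixR a : commute a x1 -> commute a x2 -> [~ x1, x2] ^ a = [~ x1, x2].
  move=> ca1 ca2; apply/conjg_fixP/commgP/cent1P.
  by rewrite groupR //; apply/cent1P/commute_sym.
suff -> : [~ n1, n2] = [~ x1, x2] by rewrite groupR.
rewrite [in LHS]def1 commMgJ; have /commgP/eqP-> := cAn _ _ Aa1 Nn2; rewrite mulg1.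
have -> : [~ x1, n2] = [~ x1, x2]; last exact: fixR.
rewrite def2 commgMJ; have /commute_sym/commgP/eqP-> := c21.
by rewrite mul1g fixR.
Qed.

(** Downward induction on [X]. Overgroups containing [A] contribute 0 because [XA] is proper:
    otherwise [N] lies in [X], forcing [X = G]. Larger overgroups not containing [A] vanish by
    induction, so [X] does too. *)
Lemma mobius_supplement0 (gT : finGroupType) (G A N : {group gT}) :
    A <| G -> N <| G -> abelian A -> A :&: N = 1 -> N \subset [~: N, N] ->
  forall X : {group gT}, X \subset G -> (X * N)%g = G -> ~~ (A \subset X) ->
    mobius X G = 0%R.
Proof.
move=> nsAG nsNG cAA tiAN pN; have [sAG nAG] := andP nsAG.
have [sNG nNG] := andP nsNG.
have cNA : A \subset 'C(N).
  apply/commG1P/trivgP; rewrite -tiAN commg_subI // subsetI.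
    by rewrite subxx (subset_trans sAG).
  by rewrite subxx (subset_trans sNG).
apply: overgroup_ind => X sXG IHX eqG nsAX.
have := sum_mobius sXG; rewrite (bigID (fun Y : {group gT} => A \subset Y)) /=.
rewrite (eq_bigl (fun Y : {group gT} => ((X <*> A)%G \subset Y) && (Y \subset G))); last first.
  by move=> Y; rewrite join_subG andbAC.
rewrite sum_mobius; last by rewrite join_subG sXG.
have /negPf-> : (X <*> A)%G != G.
  apply: contra nsAX => /eqP/(congr1 val)/= eqXA.
  have sNX : N \subset X.
    apply: (perfect_supplement_sub cAA) => //.
    by rewrite -norm_joinEl ?eqXA // (subset_trans sXG).
  by rewrite -(mulGSid sNX) eqG.
have /negPf-> : X != G by apply: contraNneq nsAX => ->.
rewrite add0r (bigD1 X) ?subxx ?sXG //= big1 ?addr0 // => Y.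
case/andP=> /andP[/andP[sXY sYG] nsAY] neYX; apply: IHX => //.
  by rewrite properEneq eq_sym neYX.
by apply/eqP; rewrite eqEsubset mul_subG //= -eqG mulSg.
Qed.

Lemma supp_sum_perfect (gT : finGroupType) (G A N : {group gT}) :
    A <| G -> N <| G -> abelian A -> A :&: N = 1 -> N \subset [~: N, N] ->
  (supp_sum G N = supp_sum (G / A)%G (N / A)%G * #|A|%:R)%R.
Proof.
move=> nsAG nsNG cAA tiAN pN; rewrite supp_sum_quotient // /supp_sum.
rewrite (bigID (fun X : {group gT} => A \subset X)) /= [X in (_ + X)%R]big1 ?addr0.
  by apply: eq_bigl => X; rewrite andbC.
move=> X /andP[/andP[sXG /eqP eqG] nsAX].
by rewrite (mobius_supplement0 nsAG nsNG) ?mulr0.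
Qed.

(** By the Frattini argument [X = Y 'N_X(W)], so the index of ['N_X(W)] in [X] is the number of
    Sylow [r]-subgroups of [Y]. *)
Lemma sum_card_subnorm_Sylow (gT : finGroupType) (r : nat) (X Y : {group gT}) :
  Y <| X -> (\sum_(W : {group gT} | r.-Sylow(Y) W) #|'N_X(W)| = #|X|)%N.
Proof.
move=> nsYX; have cardX (W : {group gT}) :
    r.-Sylow(Y) W -> (#|'N_X(W)| * #|'Syl_r(Y)| = #|X|)%N.
  move=> sylW; apply/eqP; rewrite -(eqn_pmul2r (cardG_gt0 'N_Y(W))) -mulnA.
  rewrite (card_Syl sylW) [(#|_ : _| * _)%N]mulnC Lagrange ?subsetIl //.
  have := mul_cardG Y 'N_X(W); rewrite (Frattini_arg nsYX sylW) mulnC => ->.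
  by rewrite setIA (setIidPl (normal_sub nsYX)).
have [W0 /cardX cardX0] := Sylow_exists r Y.
rewrite (eq_bigr (fun=> #|'N_X(W0)|)) => [|W /cardX].
  rewrite sum_nat_const mulnC -cardX0; congr (_ * _)%N.
  by apply: eq_card => W; rewrite inE.
rewrite -cardX0 => /eqP; rewrite eqn_pmul2r => [/eqP //|].
by have := cardG_gt0 X; rewrite -cardX0 muln_gt0 => /andP[].
Qed.

Lemma supp_sum_pcore0 (gT : finGroupType) (r : nat) (G K N : {group gT}) :
    (forall W : {group gT}, W <| G -> r.-group W -> W :=: 1) ->
    N <| G -> K <| G -> N \subset K -> r.-group (K / N) -> ~~ (K \subset N) ->
  supp_sum G N = 0%R.
Proof.
move=> Or1 nsNG nsKG sNK rKN nsKN; have [[sNG nNG] [sKG nKG]] := (andP nsNG, andP nsKG).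
rewrite /supp_sum.
rewrite (eq_bigr (fun X : {group gT} => \sum_(W : {group gT} | r.-Sylow(X :&: K) W)
                    #|'N_X(W)|%:R * mobius X G)%R); last first.
  move=> X /andP[sXG _]; rewrite -mulr_suml -natr_sum sum_card_subnorm_Sylow //.
  exact: normalGI sXG nsKG.
rewrite (exchange_big_dep xpredT) //=; apply: big1 => W _.
(* Only [W] with [WN = K] can occur: [X :&: K] covers the [r]-group [K / N], hence so does its Sylow
   subgroup [W]. *)
have [/andP[rW /eqP defK] | not_rW] := boolP (r.-group W && (W * N == K)%g); last first.
  apply: big_pred0 => X; apply: contraNF not_rW => /andP[/andP[sXG /eqP eqG] sylW].
  rewrite (pHall_pgroup sylW) /=.
  have defK : ((X :&: K) * N)%g = K.
    by rewrite setIC group_modr // eqG (setIidPl sKG).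
  have sWK : W \subset K by apply: subset_trans (pHall_sub sylW) (subsetIr _ _).
  have nNW := subset_trans sWK (subset_trans sKG nNG).
  have nNXK : X :&: K \subset 'N(N) by rewrite subIset // (subset_trans sXG).
  have := quotient_pHall nNW sylW.
  rewrite -(quotientMidr N (X :&: K)) defK => /pHall_id/(_ rKN) defKN.
  rewrite eqEsubset mul_subG //= -norm_joinEl //.
  rewrite -(quotientSGK _ (joing_subr W N)) ?(subset_trans sKG) //=.
  by rewrite quotientYidr // defKN.
have sWK : W \subset K by rewrite -defK mulG_subl.
have nsGNW : ~~ (G \subset 'N(W)).
  apply: contra nsKN => nWG; have W1 : W :=: 1.
    by apply: Or1 => //; rewrite /normal (subset_trans sWK).
  by rewrite -defK W1 mul1g.
(* To be evaluated at [D = 'N_X(W)]. *)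
pose phi (D : {group gT}) : int :=
  (if (D * N == G)%g && r.-Sylow(D :&: K) W then #|D|%:R else 0)%R.
under eq_bigl do rewrite -andbA.
rewrite -[RHS](sum_mobius_setI phi nsGNW) big_mkcondr; apply: eq_bigr => X sXG.
rewrite /phi /= setIAC Sylow_subnorm.
case: (boolP (r.-Sylow(X :&: K) W)) => [sylW | _]; last by rewrite !andbF mul0r.
suff -> : ('N_X(W) * N == G)%g = (X * N == G)%g by case: ifP; rewrite ?mul0r.
have nN (Z : {group gT}) : Z \subset G -> Z \subset 'N(N).
  by move/subset_trans; apply.
have sNXG : 'N_X(W) \subset G by rewrite subIset ?sXG.
rewrite -!norm_joinEl ?nN //; apply/eqP/eqP=> [eqG | eqG]; apply/eqP.
  by rewrite eqEsubset join_subG sXG sNG -{1}eqG genS ?setSU ?subsetIl.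
rewrite eqEsubset join_subG sNXG sNG -{1}eqG join_subG joing_subr andbT /=.
(* Here [X = (X :&: K) 'N_X(W)] by Frattini, and [K = WN] lies in the join of ['N_X(W)] and [N]. *)
have sWX : W \subset X := subset_trans (pHall_sub sylW) (subsetIl X K).
have sKj : K \subset 'N_X(W) <*> N.
  rewrite -defK mul_subG ?joing_subr //.
  by apply: subset_trans (joing_subl _ _); rewrite subsetI sWX normG.
rewrite -{1}(Frattini_arg (normalGI sXG nsKG) sylW) mul_subG ?joing_subl //.
exact: subset_trans (subsetIr X K) sKj.
Qed.

(** * The induction proving [N] solvable *)

Lemma supp_sum_neq0_quotient (gT : finGroupType) (G M N : {group gT}) :
    M <| G -> N <| G -> M \subset N -> supp_sum G N != 0%R ->
  (supp_sum G M != 0)%R /\ (supp_sum (G / M)%G (N / M)%G != 0)%R.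
Proof.
move=> nsMG nsNG sMN nzN; apply/andP; rewrite -negb_or -mulf_eq0.
by rewrite -supp_sum_mul // mulf_neq0 // pnatr_eq0 -lt0n.
Qed.

Theorem supp_sum_neq0_solvable (gT : finGroupType) (G N : {group gT}) :
    N <| G -> solvable (G / N) -> supp_sum G N != 0%R -> solvable N.
Proof.
(* The measure drops both when [G] is replaced by a proper quotient and when [N] is replaced by its
   derived subgroup. *)
have [k] := ubnP (#|G| + #|N|); elim: k gT G N => // k IHk gT G N.
rewrite ltnS => lek nsNG solGN nzN; have [sNG nNG] := andP nsNG.
have IHq (A : {group gT}) : A <| G -> A :!=: 1 ->
    supp_sum (G / A)%G (N / A)%G != 0%R -> solvable (N / A).
  move=> nsAG ntA; have [sAG nAG] := andP nsAG.
  apply: IHk; rewrite ?quotient_normal //.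
    by apply: leq_trans lek; rewrite -addSn leq_add ?ltn_quotient ?leq_quotient.
  (* [A] need not lie in [N], so the quotient of [G / A] by [N / A] is identified with [G / NA], a
     quotient of [G / N]. *)
  have nsNAG : N <*> A <| G by rewrite normalY.
  have /= -> : (N / A)%g = (N <*> A / A)%g.
    by rewrite quotientYidr // (subset_trans sNG).
  rewrite (isog_sol (third_isog (joing_subr N A) nsAG nsNAG)).
  rewrite -(isog_sol (third_isog (joing_subl N A) nsNG nsNAG)).
  exact: quotient_sol.
have [pN | npN] := boolP (N \subset [~: N, N]); last first.
  have nsN'G : [~: N, N] <| G by apply: char_normal_trans nsNG; apply: der_char 1%N N.
  have nsN'N : [~: N, N] <| N := der_normal 1 N.
  have solNN' : solvable (N / [~: N, N]) := abelian_sol (der_abelian 0 N).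
  rewrite (series_sol nsN'N) solNN' andbT.
  have [nzN' _] := supp_sum_neq0_quotient nsN'G nsNG (normal_sub nsN'N) nzN.
  apply: IHk nzN' => //.
    apply: leq_trans lek; rewrite ltn_add2l proper_card //.
    by rewrite properE normal_sub.
  have nsNN' : (N / [~: N, N] <| G / [~: N, N])%g by apply: quotient_normal.
  by rewrite (series_sol nsNN') solNN' (isog_sol (third_isog (normal_sub nsN'N) nsN'G nsNG)).
have [/existsP[A /and3P[nsAG cAA ntA]] | no_abn] :=
    boolP [exists A : {group gT}, [&& A <| G, abelian A & A :!=: 1]].
  have [tiAN | ntAN] := eqVneq (A :&: N) 1.
    rewrite (supp_sum_perfect nsAG nsNG) // mulf_eq0 negb_or in nzN.
    have [nzNA _] := andP nzN.
    rewrite (isog_sol (quotient_isog _ tiAN)) ?(subset_trans sNG) ?normal_norm //.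
    exact: IHq.
  have nsBG : A :&: N <| G by apply: normalI.
  have sBN : A :&: N \subset N := subsetIr A N.
  have [_ nzNB] := supp_sum_neq0_quotient nsBG nsNG sBN nzN.
  rewrite (series_sol (normalS sBN sNG nsBG)) (IHq _ nsBG) // andbT.
  exact: abelian_sol (abelianS (subsetIl A N) cAA).
have no_abelian (A : {group gT}) : A <| G -> abelian A -> A :=: 1.
  move=> nsAG cAA; apply/eqP; apply: contraNT no_abn => ntA.
  by apply/existsP; exists A; rewrite nsAG cAA.
have Or1 (W : {group gT}) (r : nat) : W <| G -> r.-group W -> W :=: 1.
  move=> nsWG rW; apply/eqP; apply: contraT => ntW.
  have [A [_ nsAG ntA abA]] := solvable_norm_abelem (pgroup_sol rW) nsWG ntW.
  have [p _ /abelem_abelian cAA] := is_abelemP abA.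
  by rewrite no_abelian ?eqxx in ntA.
have [sGN | nsGN] := boolP (G \subset N).
  have eqGN : G = N by apply/val_inj/eqP; rewrite eqEsubset sGN.
  rewrite -eqGN in nzN *; apply/abelian_sol/cyclic_abelian.
  by apply: contraR nzN => /supp_sum_noncyclic ->.
have ntGN : (G / N)%g != 1 by rewrite -subG1 quotient_sub1.
have [H [_ nsH ntH /is_abelemP[r _ /abelem_pgroup rH]]] :=
  solvable_norm_abelem solGN (normal_refl _) ntGN.
have [K defH sNK nsKG] := inv_quotientN nsNG nsH.
rewrite (@supp_sum_pcore0 _ r G K N) ?eqxx // in nzN.
- by move=> W nsWG; apply: Or1.
- by rewrite -defH.
- by rewrite -quotient_sub1 -?defH ?subG1 // (subset_trans (normal_sub nsKG)).
Qed.

(** * Composition factors and the conclusion *)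

Lemma comps_factor_solvable (gT : finGroupType) (G : {group gT}) (s : seq {group gT}) :
    solvable G -> path [rel x y : {group gT} | maxnormal y x x] G s ->
  all (fun p : {group gT} * {group gT} => solvable (p.1 / p.2)) (zip (G :: s) s).
Proof.
elim: s G => //= H s IHs G solG /andP[maxH pathHs].
have /andP[/proper_sub sHG _] := maxgroupp maxH.
by rewrite quotient_sol // IHs // (solvableS sHG).
Qed.

Theorem mainTheorem1 (gT sT : finGroupType) (G : {group gT}) (S : {group sT})
  (simpleS : simple S) (nonabS : ~~ abelian S)
  (notA : forall (F : finFieldType) (n : nat), (1 < n)%N -> ~ (S \isog PSL F n))
  (notD : forall (F : finFieldType) (n : nat), (4 <= n)%N ->
            (n = 4 \/ (2%N \in [pchar F])%R) -> ~ (S \isog POmegaplus F n))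
  (notE : forall (F : finFieldType), ~ (S \isog E6ad F))
  (not2A : forall (F : finFieldType) (q n : nat), #|F| = (q ^ 2)%N ->
            (1 < n)%N -> ~ (S \isog PSU F q n))
  (hS : exists s : seq {group gT}, comps G s /\ count_factors S G s = 1%N) :
  forall N : {group gT}, beta_kernel G N -> ~~ solvable (G / N).
Proof.
move=> N /maxgroupp/andP[nsNG]; rewrite mGN_neq0 => nzN.
apply/negP => solGN; have [s [/andP[_ compGs] countS]] := hS.
have solG : solvable G.
  by rewrite (series_sol nsNG) solGN (supp_sum_neq0_solvable nsNG).
have: has (fun p : {group gT} * {group gT} => (p.1 / p.2)%g \isog S) (zip (G :: s) s).
  by rewrite has_count -/(count_factors S G s) countS.
case/hasP=> p /(allP (comps_factor_solvable solG compGs)) solp /isog_sol eqsol.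
(* A solvable simple group has prime order, so [S] would be cyclic. *)
rewrite eqsol in solp; case/negP: nonabS; apply: cyclic_abelian.
exact/prime_cyclic/simple_sol_prime.
Qed.
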